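(* For each $d\ge1$ let $\Sigma=\Sigma_d$ be an invertible $d\times d$ covariance matrix and let $\boldsymbol\Delta_d\in\mathbb R^d$ with $\|\boldsymbol\Delta_d\|\ne0$. Let $\mathbf r_d$ be uniformly distributed on the unit sphere of $\mathbb R^d$ and $\mathbf r_{\Sigma,d}=\Sigma^{-1/2}\mathbf r_d$. Then for all $\epsilon>0$ there exist constants $c,C>0$, not depending on $d$, such that for all $d$ $$P\left(c\le\mathcal E_1^2(\boldsymbol\Delta_d,\mathbf r_{\Sigma,d})\,\frac{d}{\|\Sigma^{-1/2}\boldsymbol\Delta_d\|^2}\le C\right)\ge1-\epsilon.$$
   Context: $\mathcal E_1(\boldsymbol\Delta_d,\mathbf p_d)=|\langle\boldsymbol\Delta_d,\mathbf p_d\rangle|/\tau(\mathbf p_d)$ with $\tau^2(\mathbf p_d)=\mathbf p_d^T\Sigma\,\mathbf p_d$, where $\Sigma=\operatorname{cov}(\mathbf e_1(d))$ is the covariance matrix of the $d$-dimensional error vector (this is the high dimensional efficiency of change point tests based on projecting the data onto $\mathbf p_d$ when the change is $\boldsymbol\Delta_d$). $\Sigma^{-1/2}$ is the inverse of the symmetric positive definite square root of $\Sigma$; $\|\cdot\|$ is the Euclidean norm. *)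

(* Defs.v *)
From mathcomp Require Export all_boot all_order all_algebra.
From mathcomp Require Export all_classical all_reals all_analysis.

Set Implicit Arguments.
Unset Strict Implicit.
Unset Printing Implicit Defensive.

Export Order.TTheory GRing.Theory Num.Theory.
Export numFieldNormedType.Exports.

Local Open Scope classical_set_scope.
Local Open Scope ring_scope.

Section euclidean.
Context {R : realType} {d : nat}.
Implicit Types (u v : 'cV[R]_d) (A S : 'M[R]_d).

Definition dotv u v : R := (u^T *m v) 0 0.

(* The library norm `|v| on matrices is the sup norm, hence this one. *)
Definition enorm v : R := Num.sqrt (dotv v v).

Definition sym_posdef A : Prop :=
  A^T = A /\ forall v, v != 0 -> 0 < dotv v (A *m v).

(* A positive definite S has exactly one symmetric positive definite square
   root, which is the matrix selected here; 0 is only a default value. *)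
Definition sqrtmx S : 'M[R]_d :=
  xget 0 [set A | sym_posdef A /\ A *m A = S].

Definition inv_sqrtmx S : 'M[R]_d := invmx (sqrtmx S).

End euclidean.

(* S is the covariance matrix of some random vector (e_i)_i with
   square-integrable components; membership in Lfun includes measurability. *)
Definition covariance_matrix {R : realType} {d : nat} (S : 'M[R]_d) : Prop :=
  exists (disp : measure_display) (W : measurableType disp)
    (Q : probability W R) (e : 'I_d -> W -> R),
    (forall i, e i \in Lfun Q 2%:E) /\
    S = \matrix_(i, j) fine (covariance Q (e i) (e j)).

Definition borel {X : topologicalType} : set (set X) := <<s @open X >>.

Section random_vectors.
Context {R : realType} {d : nat} {disp : measure_display}.
Context {T : measurableType disp}.
Variable P : probability T R.
Implicit Type r : T -> 'cV[R]_d.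

Definition random_vector r : Prop :=
  forall B, borel B -> measurable (r @^-1` B).

(* The uniform distribution on the unit sphere is the unique Borel probability
   measure carried by the sphere which is invariant under the orthogonal
   group. Using O(d) and not SO(d) matters for d = 1, where the sphere is
   {-1, 1}. *)
Definition uniform_on_sphere r : Prop :=
  [/\ random_vector r,
      P [set w | enorm (r w) = 1] = 1%E &
      forall (O : 'M[R]_d) (B : set 'cV[R]_d), O^T *m O = 1%:M -> borel B ->
        P [set w | B (O *m r w)] = P [set w | B (r w)] ].

End random_vectors.

Section efficiency.
Context {R : realType} {d : nat}.
Variable S : 'M[R]_d.
Implicit Types Delta p : 'cV[R]_d.

Definition tau p : R := Num.sqrt (dotv p (S *m p)).

Definition efficiency Delta p : R := `|dotv Delta p| / tau p.

End efficiency.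

(* Main.v *)
Require Import Defs.
From mathcomp Require Import measurable_realfun spectral sesquilinear complex.
From mathcomp Require Import ring lra.

(* With A the square root of Sigma and u = A^-1 Delta, the projection vector
   A^-1 r has variance r^T r = 1, so the squared efficiency is <u, r>^2. As the
   law of <u, r> depends only on |u|, everything reduces to bounding
   P(c <= d X^2 <= C) from below for X = <u, r> with u a unit vector,
   uniformly in d. Since E X^2 = 1/d, Markov's inequality gives C.
   For c, rotation invariance gives E X_i^4 = 3 E X_i^2 X_j^2 for the
   coordinates X_i of r, so the sum of m of the X_i^2 has mean m/d and variance
   at most 2m/d^2; by Chebyshev some X_i with i < m satisfies X_i^2 > 1/(2d),
   except with probability at most 8/m (with m = d when d is small, there is
   no exception). In that case at most one in N of the N^m
   combinations of X_0, ..., X_(m-1) with integer coefficients below N is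
   smaller than (8d)^(-1/2) in absolute value. Each such combination is
   distributed as |a| X with |a| <= m N, and averaging over them bounds the
   probability that |X| < (8d)^(-1/2) / (m N) by 1/N + 8/m. *)

Local Open Scope classical_set_scope.
Local Open Scope ring_scope.

(** * Scalar products and integer combinations *)

Section dot_product.
Context {R : realType} {d : nat}.
Implicit Types (u v w : 'cV[R]_d) (A : 'M[R]_d) (a : R).

Lemma dotvE u v : dotv u v = \sum_i u i 0 * v i 0.
Proof. by rewrite /dotv mxE; apply: eq_bigr => i _; rewrite mxE. Qed.

Lemma dotvC u v : dotv u v = dotv v u.
Proof. by rewrite !dotvE; apply: eq_bigr => i _; rewrite mulrC. Qed.

Lemma dotvDl u v w : dotv (u + v) w = dotv u w + dotv v w.
Proof.
by rewrite !dotvE -big_split; apply: eq_bigr => i _; rewrite mxE mulrDl.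
Qed.

Lemma dotvZl a u v : dotv (a *: u) v = a * dotv u v.
Proof.
by rewrite !dotvE mulr_sumr; apply: eq_bigr => i _; rewrite mxE mulrA.
Qed.

Lemma dotvDr u v w : dotv w (u + v) = dotv w u + dotv w v.
Proof. by rewrite !(dotvC w) dotvDl. Qed.

Lemma dotvZr a u v : dotv u (a *: v) = a * dotv u v.
Proof. by rewrite !(dotvC u) dotvZl. Qed.

Lemma dotv_suml (I : finType) (F : I -> 'cV[R]_d) v :
  dotv (\sum_i F i) v = \sum_i dotv (F i) v.
Proof.
apply: (big_morph (fun u => dotv u v)) => [x y|]; first exact: dotvDl.
by rewrite -[0](scale0r 0) dotvZl mul0r.
Qed.

Lemma dotv_mulmxl A u v : dotv (A *m u) v = dotv u (A^T *m v).
Proof. by rewrite /dotv trmx_mul -mulmxA. Qed.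

Lemma dotv_ge0 v : 0 <= dotv v v.
Proof. by rewrite dotvE sumr_ge0 // => i _; rewrite -expr2 sqr_ge0. Qed.

Lemma dotv_eq0 v : (dotv v v == 0) = (v == 0).
Proof.
apply/eqP/eqP => [/eqP|->]; last by rewrite dotvE big1 // => i _; rewrite mxE mul0r.
rewrite dotvE psumr_eq0 => [/allP h|i _]; last by rewrite -expr2 sqr_ge0.
apply/matrixP => i j; rewrite ord1 !mxE.
by have := h i (mem_index_enum _); rewrite mulf_eq0 orbb => /eqP.
Qed.

Lemma enorm_sqr v : enorm v ^+ 2 = dotv v v.
Proof. by rewrite sqr_sqrtr // dotv_ge0. Qed.

Lemma dotv_delta i v : dotv (delta_mx i 0) v = v i 0.
Proof.
rewrite dotvE (bigD1 i) //= big1 ?addr0 => [|j ji]; first by rewrite mxE !eqxx mul1r.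
by rewrite mxE (negPf ji) mul0r.
Qed.

(** The squared norms of $u+v$ and $u-v$ are nonnegative. This crude form of Cauchy-Schwarz serves
    only to bound projections of unit vectors. *)
Lemma abs_dotv_le u v : `|dotv u v| <= dotv u u + dotv v v.
Proof.
have h1 := dotv_ge0 (u + v); have h2 := dotv_ge0 (u + (-1) *: v).
move: h1 h2 (dotv_ge0 u) (dotv_ge0 v).
rewrite !(dotvDl, dotvDr, dotvZl, dotvZr) (dotvC v u) => *.
by rewrite ler_norml; apply/andP; split; lra.
Qed.

(* The Householder reflection in the hyperplane orthogonal to u - v. *)
Lemma orthogonal_dotv u v : dotv u u = dotv v v ->
  exists O : 'M[R]_d, O^T *m O = 1%:M /\ forall x, dotv u (O *m x) = dotv v x.
Proof.
move=> uv; have [->|neq] := eqVneq u v.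
  by exists 1%:M; rewrite trmx1 mulmx1; split=> // x; rewrite mul1mx.
set w := u + (-1) *: v; set q := dotv w w.
have q0 : q != 0.
  rewrite dotv_eq0; apply: contra_neq neq => /eqP.
  by rewrite /w scaleN1r subr_eq0 => /eqP.
pose O := 1%:M - (2 / q) *: (w *m w^T).
have OT : O^T = O.
  by rewrite /O linearB linearZ /= trmx1 trmx_mul trmxK.
have Ox x : O *m x = x + (- (2 / q) * dotv w x) *: w.
  rewrite /O mulmxBl mul1mx -scalemxAl -mulmxA [w^T *m x]mx11_scalar.
  by rewrite mul_mx_scalar -/(dotv w x) scalerA mulNr scaleNr.
have OO (x : 'cV[R]_d) : O *m (O *m x) = x.
  rewrite !Ox dotvDr dotvZr -/q -addrA -scalerDl.
  rewrite [X in X *: w](_ : _ = 0) ?scale0r ?addr0 //.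
  by field.
exists O; split.
  apply/matrixP => i j; have /matrixP/(_ i 0) := OO (delta_mx j 0).
  rewrite OT mulmxA -colE mxE => ->.
  by rewrite !mxE eqxx andbT.
(* Equal norms give $\|w\|^2=2\langle u,w\rangle$, so the reflection takes $u$ to $u-w=v$. *)
have qE : q = 2 * dotv u w.
  rewrite /q /w !(dotvDl, dotvDr, dotvZl, dotvZr) (dotvC v u) -uv; ring.
move=> x; rewrite -{1}OT -dotv_mulmxl Ox (dotvC w u); congr dotv.
have -> : - (2 / q) * dotv u w = -1.
  move: q0; rewrite qE => q0; field.
  by move: q0; rewrite mulf_eq0 negb_or => /andP[].
by rewrite /w scalerDr scalerA mulrNN mulr1 scale1r scaleN1r addrA subrr add0r.
Qed.

End dot_product.

(** Two combinations differing only in the coefficient of [x i] are at least [s] apart, so at most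
    one of them lies in the open interval of length [s] around 0. Hence [f], which overwrites the
    [i]-th coefficient by an arbitrary one, is injective on pairs with second component in [A]. *)
Lemma card_small_combinations (R : realType) (m N : nat) (x : 'I_m -> R)
    (i : 'I_m) (s : R) : s <= `|x i| ->
  (N * #|[set a : {ffun 'I_m -> 'I_N} |
          (`| \sum_j (a j)%:R * x j | < s / 2)%R]%SET| <= N ^ m)%N.
Proof.
move=> sx; set A := [set _ | _]%SET.
pose f (p : 'I_N * {ffun 'I_m -> 'I_N}) := [ffun j => if j == i then p.1 else p.2 j].
rewrite -{1}(card_ord N) -(cardsT 'I_N) -cardsX -[X in (X ^ m)%N]card_ord.
rewrite -[X in (_ ^ X)%N]card_ord -card_ffun.
rewrite -(card_in_imset (f := f)) ?max_card //.
move=> [k a] [l b]; rewrite !inE /= => aA bA /ffunP fab.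
have kl : k = l by have := fab i; rewrite !ffunE eqxx.
have abE j : j != i -> a j = b j.
  by move=> /negPf ji; have := fab j; rewrite !ffunE ji.
suff abi : a i = b i.
  congr pair => //; apply/ffunP => j.
  by have [->|/abE] := eqVneq j i.
apply/eqP/contraT => neq.
have : `|((a i)%:R - (b i)%:R) * x i| < s.
  have -> : ((a i)%:R - (b i)%:R) * x i =
      \sum_j (a j)%:R * x j - \sum_j (b j)%:R * x j.
    rewrite -sumrB (bigD1 i) //= (big1 _ (fun j => j != i)) => [|j /abE ->].
      by rewrite addr0 mulrBl.
    by rewrite subrr.
  apply: le_lt_trans (ler_normB _ _) _; rewrite [s]splitr.
  exact: ltrD.
rewrite ltNge normrM (le_trans sx) // ler_peMl //.
wlog ab : a b k l {aA bA fab kl abE} neq / (b i < a i)%N => [h|].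
  move: (neq); rewrite -val_eqE neq_ltn => /orP[lt|lt]; last exact: (h a b).
  by rewrite distrC; apply: (h b a); rewrite // eq_sym.
rewrite -natrB ?normr_nat ?ler1n ?subn_gt0 //; exact: ltnW.
Qed.

(** * Square roots of positive definite matrices *)

Lemma trmx_horner_mx (R : comNzRingType) n (A : 'M[R]_n.+1) (p : {poly R}) :
  (horner_mx A p)^T = horner_mx A^T p.
Proof.
elim/poly_ind: p => [|p c ih]; first by rewrite !rmorph0 trmx0.
rewrite !(rmorphD, rmorphM) /= !horner_mx_X !horner_mx_C linearD /= tr_scalar_mx.
rewrite -[_ * A]/(_ *m A) trmx_mul ih; congr (_ + _).
exact: comm_mx_horner.
Qed.

(** Newton interpolation: a new node [a] is served by a multiple of [q], which vanishes at the
    earlier nodes. *)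
Lemma interpolation (F : fieldType) (f : F -> F) (s : seq F) :
  exists p : {poly F}, {in s, forall x, p.[x] = f x}.
Proof.
elim: s => [|a s [p ps]]; first by exists 0.
have [sa|nsa] := boolP (a \in s).
  by exists p => x; rewrite inE => /predU1P[->|/ps//]; exact: ps.
pose q := \prod_(b <- s) ('X - b%:P).
have qa : q.[a] != 0 by rewrite -/(root q a) root_prod_XsubC.
exists (p + ((f a - p.[a]) / q.[a]) *: q) => x; rewrite !hornerE.
rewrite inE => /predU1P[->|xs]; first by rewrite divfK // addrC subrK.
suff -> : q.[x] = 0 by rewrite mulr0 addr0 ps.
by apply/rootP; rewrite root_prod_XsubC.
Qed.

Section symmetric_root.
Local Open Scope complex_scope.
Variables (R : realType) (n : nat) (S : 'M[R]_n.+1).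
Hypotheses (S_sym : S^T = S) (S_psd : forall v, 0 <= dotv v (S *m v)).

Let A : 'M[R[i]]_n.+1 := map_mx (real_complex R) S.

Lemma eigenvalue_psd_ge0 (t : R) : eigenvalue S t -> 0 <= t.
Proof.
move=> /eigenvalueP[v vS v0].
have := S_psd v^T; rewrite -{1}S_sym -trmx_mul vS linearZ /= dotvZr.
rewrite pmulr_lge0 // lt_def dotv_ge0 andbT dotv_eq0.
by apply: contra_neq v0 => /(congr1 trmx); rewrite trmxK trmx0.
Qed.

(* Apply to S a real polynomial sending each eigenvalue to its fourth root. *)
Lemma symmetric_fourth_root : exists Q : 'M[R]_n.+1, Q^T = Q /\ Q ^+ 4 = S.
Proof.
have Ah : A \is hermsymmx.
  apply: realsym_hermsym; last first.
    by apply/mxOverP => i j; rewrite mxE; apply/complex_realP; exists (S i j).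
  by apply/is_hermitianmxP; rewrite expr0 scale1r map_mx_id // map_trmx S_sym.
have Ad : A = invmx (spectralmx A) *m diag_mx (spectral_diag A) *m spectralmx A.
  exact/orthomx_spectralP/hermitian_normalmx.
have Dr := hermitian_spectral_diag_real Ah.
move: Ad Dr (spectral_unit A).
set U := spectralmx A; set D := spectral_diag A => Ad Dr Uu.
pose t j := complex.Re (D 0 j).
have tE j : D 0 j = (t j)%:C.
  have /complex_realP[k E] : D 0 j \is Num.real by exact: (mxOverP Dr).
  by rewrite /t E.
(* The diagonalization is complex, but [A] has the characteristic polynomial of [S], so [t j] is a
   real eigenvalue of [S]. *)
have t_ge0 j : 0 <= t j.
  apply: eigenvalue_psd_ge0; rewrite eigenvalue_root_char.
  rewrite -(fmorph_root (real_complex R)) map_char_poly -eigenvalue_root_char.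
  apply/eigenvalueP; exists (row j U); last first.
    apply/eqP => U0; have /row_freeP[V UV] : row_free U by rewrite row_free_unit.
    have := congr1 (mulmx^~ V) U0; rewrite -row_mul UV mul0mx.
    by move=> /matrixP/(_ 0 j)/eqP; rewrite !mxE eqxx oner_eq0.
  rewrite -row_mul -/A {1}Ad !mulmxA mulmxV // mul1mx mul_diag_mx.
  by apply/rowP => k; rewrite !mxE tE.
have [q qE] := interpolation _ (fun x => Num.sqrt (Num.sqrt x)) (codom t).
exists (horner_mx S q); split; first by rewrite trmx_horner_mx S_sym.
rewrite -rmorphXn /=; apply: (map_mx_inj (f := real_complex R)) => /=.
rewrite map_horner_mx -/A {1}Ad horner_mx_uconjC // horner_mx_diag [RHS]Ad.
congr (_ *m diag_mx _ *m _); apply/rowP => j.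
rewrite mxE tE horner_map /= horner_exp qE ?codom_f //.
by rewrite -[4%N]/(2 * 2)%N exprM !sqr_sqrtr // sqrtr_ge0.
Qed.

End symmetric_root.

(** The root is $Q^2$ with $Q$ a symmetric fourth root: its quadratic form $\|Qv\|^2$ vanishes only
    if $Sv=Q^4v=0$, which invertibility of $S$ excludes for $v\ne0$. *)
Lemma sqrtmxP (R : realType) d (S : 'M[R]_d) :
  S^T = S -> (forall v, 0 <= dotv v (S *m v)) -> S \in unitmx ->
  sym_posdef (sqrtmx S) /\ sqrtmx S *m sqrtmx S = S.
Proof.
move=> S_sym S_psd Su; suff ex : exists Q, sym_posdef Q /\ Q *m Q = S.
  exact: (@xgetPex _ 0 [set A | sym_posdef A /\ A *m A = S]%classic ex).
(* Powers and polynomials of matrices require a positive size, so the empty matrix is treated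
   apart. *)
case: d => [|d] in S S_sym S_psd Su *.
  exists 0; split; last by apply/matrixP => -[].
  split; first exact: trmx0.
  by move=> v /eqP[]; apply/matrixP => -[].
have [Q [QT Q4]] := symmetric_fourth_root _ _ _ S_sym S_psd.
exists (Q *m Q); split; last by rewrite -Q4 -[4%N]/(2 + 2)%N exprD.
split; first by rewrite trmx_mul QT.
move=> v v0; rewrite -mulmxA -{1}QT -dotv_mulmxl lt_def dotv_ge0 andbT dotv_eq0.
apply: contra_neq v0 => Qv.
have : S *m v = 0.
  by rewrite -Q4 -[4%N]addn1 exprD expr1 -[_ * Q]/(_ *m Q) -mulmxA Qv mulmx0.
by move=> /(congr1 (mulmx (invmx S))); rewrite mulKmx // mulmx0.
Qed.

(** * Moments of spherically symmetric vectors *)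

Section bounded_measurable.
Context {R : realType} {disp : measure_display} {T : measurableType disp}.
Variable P : probability T R.
Implicit Types f g : T -> R.

(** The bound holds at every point: this class is closed under sums and products and lies in $L^1$,
    which settles integrability for all moments below. *)
Definition bounded_mfun f : Prop :=
  measurable_fun setT f /\ exists M : R, forall w, `|f w| <= M.

Lemma bounded_mfunD f g :
  bounded_mfun f -> bounded_mfun g -> bounded_mfun (fun w => f w + g w).
Proof.
move=> [mf [M fM]] [mg [N gN]]; split; first exact: measurable_funD.
by exists (M + N) => w; rewrite (le_trans (ler_normD _ _)) ?lerD.
Qed.

Lemma bounded_mfunM f g :
  bounded_mfun f -> bounded_mfun g -> bounded_mfun (fun w => f w * g w).
Proof.
move=> [mf [M fM]] [mg [N gN]]; split; first exact: measurable_funM.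
by exists (M * N) => w; rewrite normrM ler_pM.
Qed.

Lemma bounded_mfun_cst (a : R) : bounded_mfun (fun=> a).
Proof. by split; [exact: measurable_cst|exists `|a|]. Qed.

Lemma bounded_mfunX f n : bounded_mfun f -> bounded_mfun (fun w => f w ^+ n).
Proof.
move=> bf; elim: n => [|n ih]; first exact: bounded_mfun_cst.
rewrite (_ : (fun w => _) = (fun w => f w * f w ^+ n)).
  exact: bounded_mfunM.
by apply/funext => w; rewrite exprS.
Qed.


Lemma bounded_mfun_sum (I : Type) (s : seq I) (F : I -> T -> R) :
  (forall i, bounded_mfun (F i)) -> bounded_mfun (fun w => \sum_(i <- s) F i w).
Proof.
move=> bF; elim: s => [|i s ih].
  rewrite (_ : (fun w => _) = (fun=> 0)); first exact: bounded_mfun_cst.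
  by apply/funext => w; rewrite big_nil.
rewrite (_ : (fun w => _) = (fun w => F i w + \sum_(j <- s) F j w)).
  exact: bounded_mfunD.
by apply/funext => w; rewrite big_cons.
Qed.

Lemma bounded_mfun_indic (A : set T) : measurable A -> bounded_mfun (\1_A).
Proof.
move=> mA; split; first exact: measurable_indic.
by exists 1 => w; rewrite indicE; case: (_ \in _); rewrite ?normr1 ?normr0.
Qed.

Lemma bounded_mfun_integrable f :
  bounded_mfun f -> P.-integrable setT (EFin \o f).
Proof.
move=> [mf [M fM]]; apply: measurable_bounded_integrable => //.
  by apply: (le_lt_trans (probability_le1 P measurableT)); rewrite ltry.
by exists M; split; [exact: num_real|move=> x Mx w _; exact: le_trans (ltW Mx)].
Qed.

Definition mean f : R := \int[P]_w f w.

Lemma meanD f g : bounded_mfun f -> bounded_mfun g ->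
  mean (fun w => f w + g w) = mean f + mean g.
Proof. by move=> bf bg; apply: RintegralD => //; exact: bounded_mfun_integrable. Qed.

Lemma meanZ (a : R) f : bounded_mfun f -> mean (fun w => a * f w) = a * mean f.
Proof. by move=> bf; apply: RintegralZl => //; exact: bounded_mfun_integrable. Qed.

Lemma mean_cst (a : R) : mean (fun=> a) = a.
Proof.
rewrite /mean Rintegral_cst // -[RHS]mulr1; congr (_ * _).
exact: (congr1 fine (probability_setT P)).
Qed.

Lemma mean_sum (I : Type) (s : seq I) (F : I -> T -> R) :
  (forall i, bounded_mfun (F i)) ->
  mean (fun w => \sum_(i <- s) F i w) = \sum_(i <- s) mean (F i).
Proof.
move=> bF; elim: s => [|i s ih].
  rewrite big_nil -[RHS](mean_cst 0); congr mean.
  by apply/funext => w; rewrite big_nil.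
rewrite big_cons -ih -meanD //; last exact: bounded_mfun_sum.
by congr mean; apply/funext => w; rewrite big_cons.
Qed.

Lemma le_mean f g : bounded_mfun f -> bounded_mfun g ->
  (forall w, f w <= g w) -> mean f <= mean g.
Proof. by move=> bf bg fg; apply: le_Rintegral => //; exact: bounded_mfun_integrable. Qed.

Definition prob (A : set T) : R := fine (P A).

Lemma probE A : measurable A -> P A = (prob A)%:E.
Proof. by move=> mA; rewrite /prob fineK // fin_num_measure. Qed.

Lemma mean_indic A : measurable A -> mean (\1_A) = prob A.
Proof.
by move=> mA; rewrite /mean /Rintegral integral_indic // setIT.
Qed.

Lemma le_prob A B : measurable A -> measurable B -> A `<=` B -> prob A <= prob B.
Proof. by move=> mA mB AB; rewrite fine_le ?fin_num_measure // le_measure ?inE. Qed.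

Lemma measurable_cst_le f (c : R) :
  measurable_fun setT f -> measurable [set w | c <= f w].
Proof.
move=> mf; have -> : [set w | c <= f w] = setT `&` f @^-1` `[c, +oo[.
  by rewrite setTI; apply/seteqP; split => w /=; rewrite in_itv /= andbT.
exact: mf.
Qed.

Lemma measurable_le_cst f (c : R) :
  measurable_fun setT f -> measurable [set w | f w <= c].
Proof.
move=> mf; have -> : [set w | f w <= c] = setT `&` f @^-1` `]-oo, c].
  by rewrite setTI; apply/seteqP; split => w /=; rewrite in_itv.
exact: mf.
Qed.

Lemma measurable_norm_lt f (c : R) :
  measurable_fun setT f -> measurable [set w | `|f w| < c].
Proof.
move=> mf; have -> : [set w | `|f w| < c] = setT `&` f @^-1` `](- c), c[.
  by rewrite setTI; apply/seteqP; split => w /=; rewrite in_itv /= ltr_norml.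
exact: mf.
Qed.

Lemma markov_bound f (c : R) : bounded_mfun f -> (forall w, 0 <= f w) ->
  0 < c -> prob [set w | c <= f w] <= mean f / c.
Proof.
move=> bf f0 c0; have [mf _] := bf.
have mA : measurable [set w | c <= f w] by exact: measurable_cst_le.
rewrite ler_pdivlMr // mulrC -mean_indic // -meanZ //; last exact: bounded_mfun_indic.
apply: le_mean => //.
  apply: bounded_mfunM; [exact: bounded_mfun_cst|exact: bounded_mfun_indic].
move=> w; rewrite indicE; have [|_] := boolP (w \in _); last by rewrite mulr0 f0.
by rewrite mulr1 inE.
Qed.

(** Both means are integrals of [phi] against pushforward measures that agree on measurable sets;
    [phi] is nonnegative so that the change of variables applies directly. *)
Lemma mean_comp_law (f g : T -> R) (phi : R -> R) :
  measurable_fun setT f -> measurable_fun setT g ->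
  measurable_fun setT phi -> (forall x, 0 <= phi x) ->
  (forall B : set R, measurable B -> P (f @^-1` B) = P (g @^-1` B)) ->
  mean (phi \o f) = mean (phi \o g).
Proof.
move=> mf mg mphi phi0 fg; rewrite /mean /Rintegral.
have mphiE : measurable_fun setT (EFin \o phi) by exact/measurable_EFinP.
have E h : measurable_fun setT h ->
    (\int[P]_w ((phi \o h) w)%:E = \int[pushforward P h]_y (phi y)%:E)%E.
  move=> mh; rewrite ge0_integral_pushforward //.
    by move=> y _; rewrite lee_fin.
rewrite !E //; congr fine.
by apply: eq_measure_integral => A mA _; exact: fg.
Qed.

End bounded_measurable.

(** * Moments, small balls and concentration on the sphere *)

Section spherical.
Context {R : realType} {disp : measure_display} {T : measurableType disp}.
Variables (P : probability T R) (d : nat) (X : T -> 'cV[R]_d).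
Hypothesis d_gt0 : (0 < d)%N.
Hypothesis X_meas : forall a, measurable_fun setT (fun w => dotv a (X w)).
Hypothesis X_unit : forall w, dotv (X w) (X w) = 1.
(** The form in which rotation invariance is used: it speaks of one-dimensional projections. *)
Hypothesis X_law : forall a b, dotv a a = dotv b b ->
  forall B : set R, measurable B ->
  P [set w | B (dotv a (X w))] = P [set w | B (dotv b (X w))].

Let bounded_dotv a : bounded_mfun (fun w => dotv a (X w)).
Proof.
split=> //; exists (dotv a a + 1) => w.
by rewrite (le_trans (abs_dotv_le _ _)) // X_unit.
Qed.

Let bounded_dotvX a n : bounded_mfun (fun w => dotv a (X w) ^+ n).
Proof. exact/bounded_mfunX/bounded_dotv. Qed.

Let e (i : 'I_d) : 'cV[R]_d := delta_mx i 0.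

Let dotv_e i j : dotv (e i) (e j) = (i == j)%:R.
Proof. by rewrite dotv_delta mxE eqxx andbT. Qed.

Let sum_sqr w : \sum_i dotv (e i) (X w) ^+ 2 = 1.
Proof. by rewrite -(X_unit w) dotvE; apply: eq_bigr => i _; rewrite dotv_delta. Qed.

Lemma mean_even_power_law a b n : dotv a a = dotv b b ->
  mean P (fun w => dotv a (X w) ^+ n.*2) = mean P (fun w => dotv b (X w) ^+ n.*2).
Proof.
move=> ab; apply: (@mean_comp_law _ _ _ P _ _ (fun x => x ^+ n.*2)) => //.
- by move=> x; rewrite -mul2n exprM exprn_ge0 // sqr_ge0.
- by move=> B mB; exact: X_law.
Qed.

(** All [d] coordinates have the same second moment as $\langle u,X\rangle$, and their squares add
    up to 1. *)
Lemma mean_sqr_dotv u : dotv u u = 1 ->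
  mean P (fun w => dotv u (X w) ^+ 2) = d%:R^-1.
Proof.
move=> u1; have d0 : d%:R != 0 :> R by rewrite pnatr_eq0 -lt0n.
apply: (mulfI d0); rewrite divff //.
transitivity (mean P (fun w => \sum_i dotv (e i) (X w) ^+ 2)).
  rewrite mean_sum => [|i]; last exact: bounded_dotvX.
  transitivity (\sum_(i < d) mean P (fun w => dotv u (X w) ^+ 2)).
    by rewrite sumr_const card_ord mulr_natl.
  apply: eq_bigr => i _.
  by apply: (@mean_even_power_law _ _ 1%N); rewrite u1 dotv_e eqxx.
by rewrite -[RHS](mean_cst P); congr mean; apply/funext => w; exact: sum_sqr.
Qed.

Let mu22 i j := mean P (fun w => dotv (e i) (X w) ^+ 2 * dotv (e j) (X w) ^+ 2).

(** [i0] is a reference coordinate; by [mean_even_power_law] every coordinate gives the same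
    value. *)
Let fourth (i0 : 'I_d) := mean P (fun w => dotv (e i0) (X w) ^+ 4).

Let mu22_diag i0 i : mu22 i i = fourth i0.
Proof.
rewrite /mu22 /fourth -(@mean_even_power_law (e i) _ 2%N); last by rewrite !dotv_e !eqxx.
by congr mean; apply/funext => w; rewrite -exprD.
Qed.

(* Expand (a + b)^4 + (a - b)^4, where a = <e_i, X>, b = <e_j, X>, and
   <e_i +- e_j, X> has the law of sqrt 2 <e_i, X>. *)
Let mu22_offdiag i0 i j : i != j -> 3 * mu22 i j = fourth i0.
Proof.
move=> ij; pose q (c : R) := mean P (fun w => dotv (e i + c *: e j) (X w) ^+ 4).
have qE c : c ^+ 2 = 1 -> q c = 4 * fourth i0.
  move=> c2; rewrite /q (@mean_even_power_law _ (Num.sqrt 2 *: e i0) 2%N).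
    rewrite /fourth -meanZ; last exact: bounded_dotvX.
    congr mean; apply/funext => w; rewrite dotvZl exprMn; congr (_ * _).
    by rewrite -[2.*2]/(2 * 2)%N exprM sqr_sqrtr // -natrX.
  rewrite !(dotvDl, dotvDr, dotvZl, dotvZr) !dotv_e !eqxx.
  rewrite (negPf ij) eq_sym (negPf ij) !mulr0 !mulr1 -!expr2 c2 sqr_sqrtr //.
  by rewrite addr0 add0r.
have : q 1 + q (-1) = 2 * mu22 i i + 2 * mu22 j j + 12 * mu22 i j.
  rewrite /q /mu22 -!meanZ -?meanD;
    try by do ?[apply: bounded_mfunD|apply: bounded_mfunM];
       rewrite //; exact: bounded_mfun_cst || exact: bounded_dotvX.
  congr mean; apply/funext => w; rewrite !dotvDl !dotvZl; ring.
rewrite !qE ?expr1n ?sqrrN ?expr1n // !(mu22_diag i0) => h; lra.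
Qed.


(** Of the $m^2$ products in the expanded square, $m$ are diagonal with mean [fourth i0] and the
    others have a third of it: $m+m(m-1)/3=m(m+2)/3$. *)
Let mean_sqr_sum_sqr i0 m (h : 'I_m -> 'I_d) : injective h ->
  mean P (fun w => (\sum_k dotv (e (h k)) (X w) ^+ 2) ^+ 2) =
  m%:R * (m%:R + 2) / 3 * fourth i0.
Proof.
move=> h_inj.
transitivity (mean P (fun w => \sum_k \sum_l
    dotv (e (h k)) (X w) ^+ 2 * dotv (e (h l)) (X w) ^+ 2)).
  by congr mean; apply/funext => w; rewrite expr2 big_distrlr.
have b22 k l : bounded_mfun (fun w =>
    dotv (e (h k)) (X w) ^+ 2 * dotv (e (h l)) (X w) ^+ 2).
  by apply: bounded_mfunM; exact: bounded_dotvX.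
rewrite mean_sum => [|k]; last exact: bounded_mfun_sum.
transitivity (\sum_(k < m) (m%:R + 2) / 3 * fourth i0); last first.
  by rewrite sumr_const card_ord -mulr_natl; field.
apply: eq_bigr => k _; rewrite mean_sum //.
transitivity (\sum_(l < m) (fourth i0 / 3 + (l == k)%:R * (2 / 3 * fourth i0))).
  apply: eq_bigr => l _; rewrite -/(mu22 (h k) (h l)).
  have [->|lk] := eqVneq l k; first by rewrite (mu22_diag i0) mul1r; field.
  have /(mu22_offdiag i0) <- : h k != h l by rewrite (inj_eq h_inj) eq_sym.
  by rewrite mul0r addr0; field.
rewrite big_split /= sumr_const card_ord (bigD1 k) //= big1 => [|l /negPf ->]; last first.
  by rewrite mul0r.
by rewrite eqxx mul1r addr0 -mulr_natl; field.
Qed.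

(** For all [d] coordinates together the sum of squares is 1, so [mean_sqr_sum_sqr] becomes an
    equation for [fourth i0]. *)
Let fourthE i0 : fourth i0 = 3 / (d%:R * (d%:R + 2)).
Proof.
have d0 : d%:R != 0 :> R by rewrite pnatr_eq0 -lt0n.
have d2 : d%:R + 2 != 0 :> R by rewrite -natrD pnatr_eq0 addn2.
have := mean_sqr_sum_sqr i0 _ _ (@inj_id 'I_d).
rewrite (_ : (fun w => _) = fun=> 1); last first.
  by apply/funext => w; rewrite sum_sqr expr1n.
rewrite mean_cst => h.
apply: (mulfI (x := d%:R * (d%:R + 2) / 3)).
  by rewrite !mulf_neq0 // invr_neq0 // pnatr_eq0.
by rewrite -h; field; rewrite d0 d2.
Qed.

(** Chebyshev: the mean is $m/d$, the variance at most $2m/d^2$ and the deviation at least $m/(2d)$,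
    which gives $(2m/d^2)(2d/m)^2=8/m$. *)
Lemma prob_sum_sqr_small m (h : 'I_m -> 'I_d) : injective h -> (0 < m)%N ->
  prob P [set w | \sum_k dotv (e (h k)) (X w) ^+ 2 <= m%:R / (2 * d%:R)]
    <= 8 / m%:R.
Proof.
move=> h_inj m_gt0; pose i0 := Ordinal d_gt0.
have d0 : 0 < d%:R :> R by rewrite ltr0n.
have m0 : 0 < m%:R :> R by rewrite ltr0n.
pose S w := \sum_k dotv (e (h k)) (X w) ^+ 2.
pose f w := (S w + - (m%:R / d%:R)) ^+ 2.
have bS : bounded_mfun S by apply: bounded_mfun_sum => k; exact: bounded_dotvX.
have bf : bounded_mfun f.
  by apply: bounded_mfunX; apply: bounded_mfunD => //; exact: bounded_mfun_cst.
have meanS : mean P S = m%:R / d%:R.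
  rewrite mean_sum => [|k]; last exact: bounded_dotvX.
  under eq_bigr do rewrite mean_sqr_dotv ?dotv_e ?eqxx //.
  by rewrite sumr_const card_ord mulr_natl.
have meanf : mean P f <= 2 * m%:R / d%:R ^+ 2.
  have -> : mean P f =
      m%:R * (m%:R + 2) / (d%:R * (d%:R + 2)) - (m%:R / d%:R) ^+ 2.
    transitivity (mean P (fun w => (S w ^+ 2 + - (2 * m%:R / d%:R) * S w) +
        (m%:R / d%:R) ^+ 2)).
      by congr mean; apply/funext => w; rewrite /f; ring.
    rewrite meanD ?mean_cst; [|apply: bounded_mfunD|exact: bounded_mfun_cst].
    - rewrite meanD ?meanZ //; last 2 first.
      + exact: bounded_mfunX.
      + by apply: bounded_mfunM => //; exact: bounded_mfun_cst.
      rewrite meanS (mean_sqr_sum_sqr i0) // fourthE; field.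
      by rewrite -natrD !pnatr_eq0 addn2 -lt0n d_gt0.
    - exact: bounded_mfunX.
    - by apply: bounded_mfunM => //; exact: bounded_mfun_cst.
  (* As $2m+m^2=m(m+2)$, only the denominators $d^2\le d(d+2)$ remain to be compared. *)
  rewrite lerBlDr expr_div_n -mulrDl [leLHS]mulrC [leRHS]mulrC.
  rewrite [X in _ <= _ * X](_ : _ = m%:R * (m%:R + 2)); last by ring.
  rewrite ler_wpM2r ?mulr_ge0 ?addr_ge0 ?ler0n // lef_pV2 ?posrE.
  - by rewrite expr2 ler_pM2l // lerDl.
  - by rewrite mulr_gt0 ?addr_gt0.
  - by rewrite exprn_gt0.
have c0 : 0 < (m%:R / (2 * d%:R)) ^+ 2 :> R.
  by rewrite exprn_gt0 // divr_gt0 // mulr_gt0.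
apply: (@le_trans _ _ (prob P [set w | (m%:R / (2 * d%:R)) ^+ 2 <= f w])).
  apply: le_prob.
  - by apply: measurable_le_cst; have [] := bS.
  - by apply: measurable_cst_le; have [] := bf.
  move=> w /=; rewrite -/(S w) => Sw.
  rewrite /f -[leRHS]sqrrN opprD opprK addrC.
  have -> : m%:R / (2 * d%:R) = m%:R / d%:R - m%:R / (2 * d%:R) :> R.
    by field; rewrite pnatr_eq0 -lt0n.
  rewrite ler_pXn2r ?nnegrE ?lerB //.
  - rewrite subr_ge0 ler_pM2l // lef_pV2 ?posrE ?mulr_gt0 //.
    by lra.
  - rewrite subr_ge0 (le_trans Sw) // ler_pM2l // lef_pV2 ?posrE ?mulr_gt0 //.
    by lra.
apply: le_trans (markov_bound P f _ bf _ c0) _ => [w|]; first exact: sqr_ge0.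
rewrite ler_pdivrMr // (le_trans meanf) // le_eqVlt; apply/orP; left; apply/eqP.
by field; rewrite !pnatr_eq0 -!lt0n d_gt0.
Qed.

(* Average over all integer combinations of X_(h 0), ..., X_(h m.-1) with
   coefficients below N: each is dominated in law by m * N * <u, X>, and
   if some |X_(h k)| >= s, then at most one in N of them is smaller than s/2. *)
Lemma small_ball_split m (h : 'I_m -> 'I_d) N (s : R) u :
  (0 < m)%N -> (0 < N)%N -> 0 < s -> dotv u u = 1 ->
  prob P [set w | `|dotv u (X w)| < s / (2 * (m%:R * N%:R))] <=
  N%:R^-1 + prob P [set w | \sum_k dotv (e (h k)) (X w) ^+ 2 <= m%:R * s ^+ 2].
Proof.
move=> m_gt0 N_gt0 s_gt0 u1; set bad := [set w | _ <= _].
have m0 : 0 < m%:R :> R by rewrite ltr0n.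
have N0 : 0 < N%:R :> R by rewrite ltr0n.
pose v (a : {ffun 'I_m -> 'I_N}) := \sum_k (a k)%:R *: e (h k).
pose A a := [set w | `|dotv (v a) (X w)| < s / 2].
have mA a : measurable (A a) by exact: measurable_norm_lt.
have mbad : measurable bad.
  have [mf _] : bounded_mfun (fun w => \sum_k dotv (e (h k)) (X w) ^+ 2).
    by apply: bounded_mfun_sum => k; exact: bounded_dotvX.
  exact: measurable_le_cst.
have vv a : dotv (v a) (v a) <= (m%:R * N%:R) ^+ 2.
  rewrite /v dotv_suml.
  apply: (@le_trans _ _ (\sum_(k < m) m%:R * N%:R ^+ 2)); last first.
    by rewrite sumr_const card_ord -(mulr_natl (_ * _)) mulrA -expr2 exprMn.
  apply: ler_sum => k _; rewrite dotvC dotv_suml.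
  apply: (@le_trans _ _ (\sum_(l < m) N%:R ^+ 2)); last first.
    by rewrite sumr_const card_ord mulr_natl.
  apply: ler_sum => l _; rewrite dotvZl dotvZr dotv_e expr2.
  apply: ler_pM; rewrite ?mulr_ge0 ?ler0n ?ler_nat //; first exact: ltnW.
  by case: (_ == _); rewrite ?mulr1 ?mulr0 ?ler0n // ler_nat ltnW.
have pA a : prob P [set w | `|dotv u (X w)| < s / (2 * (m%:R * N%:R))] <= prob P (A a).
  (* [v a] and [q *: u] have the same norm, hence projections with the same law, and [q] is at most
     $mN$ by [vv]. *)
  pose q := Num.sqrt (dotv (v a) (v a)).
  have q0 : 0 <= q by exact: sqrtr_ge0.
  have qK : q <= m%:R * N%:R.
    by rewrite -(ler_pXn2r (n := 2)) ?nnegrE ?mulr_ge0 ?ler0n // sqr_sqrtr ?dotv_ge0.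
  have -> : prob P (A a) = prob P [set w | `|dotv (q *: u) (X w)| < s / 2].
    congr fine.
    have := @X_law (v a) (q *: u) _ [set x | `|x| < s / 2].
    apply; last exact: measurable_norm_lt.
    by rewrite dotvZl dotvZr u1 mulr1 -expr2 sqr_sqrtr ?dotv_ge0.
  apply: le_prob; [exact: measurable_norm_lt|exact: measurable_norm_lt|].
  move=> w /=; rewrite dotvZl normrM (ger0_norm q0) => lt_w.
  apply: (@le_lt_trans _ _ (m%:R * N%:R * `|dotv u (X w)|)).
    by rewrite ler_wpM2r.
  move: lt_w; rewrite ltr_pdivlMr ?mulr_gt0 // => lt_w.
  rewrite ltr_pdivlMr //; apply: le_lt_trans lt_w.
  by rewrite le_eqVlt; apply/orP; left; apply/eqP; ring.
(* Pointwise count of the small combinations: at most $N^m/N$ off [bad], and trivially at most $N^m$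
   on it. *)
have count w : \sum_a \1_(A a) w <= N%:R ^+ m / N%:R + N%:R ^+ m * \1_bad w :> R.
  have -> : \sum_a \1_(A a) w =
      #|[set a : {ffun 'I_m -> 'I_N} |
         `|\sum_k (a k)%:R * dotv (e (h k)) (X w)| < s / 2]%SET|%:R :> R.
    rewrite -sum1_card natr_sum [RHS]big_mkcond; apply: eq_bigr => a _.
    have va : dotv (v a) (X w) = \sum_k (a k)%:R * dotv (e (h k)) (X w).
      by rewrite dotv_suml; apply: eq_bigr => k _; rewrite dotvZl.
    rewrite indicE finset.inE -va.
    have -> : (w \in A a) = (`|dotv (v a) (X w)| < s / 2) by apply/idP/idP; rewrite inE.
    by case: ifP.
  rewrite indicE; have [wbad|] := boolP (w \in bad).
    rewrite mulr1 -natrX; apply: (@le_trans _ _ (N ^ m)%:R).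
      by rewrite ler_nat (leq_trans (max_card _)) // card_ffun !card_ord.
    by rewrite lerDr divr_ge0 // ler0n.
  rewrite notin_setE /bad /= => /negP; rewrite -ltNge => sum_lt.
  (* If all these coordinates were below [s] in absolute value, the sum of squares would be at most
     $ms^2$. *)
  have [k sk] : exists k, s <= `|dotv (e (h k)) (X w)|.
    apply/existsP; apply: contraLR sum_lt => /existsPn lts.
    rewrite -leNgt; apply: (@le_trans _ _ (\sum_(k < m) s ^+ 2)); last first.
      by rewrite sumr_const card_ord mulr_natl.
    apply: ler_sum => k _; rewrite -real_normK ?num_real //.
    rewrite ler_pXn2r ?nnegrE ?(ltW s_gt0) //.
    by have := lts k; rewrite -ltNge => /ltW.
  rewrite mulr0 addr0 ler_pdivlMr // mulrC -natrM -natrX ler_nat.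
  exact: (card_small_combinations R m N (fun l => dotv (e (h l)) (X w)) k s sk).
have Nm0 : 0 < N%:R ^+ m :> R by exact: exprn_gt0.
(* Multiplied by the number $N^m$ of combinations, the left side is at most the sum of the
   [prob P (A a)], which is the mean of the count. *)
rewrite -(ler_pM2l Nm0).
apply: (@le_trans _ _ (\sum_a prob P (A a))).
  apply: (@le_trans _ _ (\sum_(a : {ffun 'I_m -> 'I_N})
      prob P [set w | `|dotv u (X w)| < s / (2 * (m%:R * N%:R))])).
    by rewrite sumr_const card_ffun !card_ord -(mulr_natl (prob _ _)) natrX.
  by apply: ler_sum => a _; exact: pA.
under eq_bigr do rewrite -mean_indic //.
rewrite -mean_sum => [|a]; last exact: bounded_mfun_indic.
rewrite mulrDr -(mean_indic P _ mbad) -meanZ; last exact: bounded_mfun_indic.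
rewrite -(mean_cst P (_ / _)) -meanD; last 2 first.
- exact: bounded_mfun_cst.
- by apply: bounded_mfunM; [exact: bounded_mfun_cst|exact: bounded_mfun_indic].
apply: le_mean => //.
- by apply: bounded_mfun_sum => a; exact: bounded_mfun_indic.
- apply: bounded_mfunD; first exact: bounded_mfun_cst.
  by apply: bounded_mfunM; [exact: bounded_mfun_cst|exact: bounded_mfun_indic].
Qed.

(** [small_ball_split] with $N=n$ and $m=\min(n,d)$: the errors $1/n$ and $8/n$ add up to $9/n$. *)
Lemma small_ball n u : (0 < n)%N -> dotv u u = 1 ->
  prob P [set w | d%:R * dotv u (X w) ^+ 2 <= (9 * n%:R ^+ 4)^-1] <= 9 / n%:R.
Proof.
move=> n_gt0 u1.
have n0 : 0 < n%:R :> R by rewrite ltr0n.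
have d0 : 0 < d%:R :> R by rewrite ltr0n.
(* Chosen so that $ms^2$ is the threshold $m/(2d)$ of [prob_sum_sqr_small]. *)
pose s : R := Num.sqrt (2 * d%:R)^-1.
have s_gt0 : 0 < s by rewrite sqrtr_gt0 invr_gt0 mulr_gt0.
have s2 : s ^+ 2 = (2 * d%:R)^-1 by rewrite sqr_sqrtr // invr_ge0 mulr_ge0 // ler0n.
have [m [h [m_gt0 le_mn prob_bad]]] : exists m (h : 'I_m -> 'I_d),
  [/\ (0 < m)%N, (m <= n)%N &
  prob P [set w | \sum_k dotv (e (h k)) (X w) ^+ 2 <= m%:R * s ^+ 2] <= 8 / n%:R].
  have [le_nd|lt_dn] := leqP n d.
    exists n, (widen_ord le_nd); split=> //; rewrite s2.
    by apply: prob_sum_sqr_small => // i j /(congr1 val)/= /val_inj.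
  (* With all coordinates the sum of squares is 1, above the threshold $ds^2=1/2$, so the event is
     empty. *)
  exists d, id; split=> //; first exact: ltnW.
  rewrite (_ : [set w | _] = set0) ?/prob ?measure0 ?divr_ge0 ?ler0n //.
  apply/seteqP; split=> w //=; rewrite sum_sqr s2.
  rewrite ler_pdivlMr ?mulr_gt0 // mul1r; move: d0 => /[swap]; lra.
have m0 : 0 < m%:R :> R by rewrite ltr0n.
have := small_ball_split _ h _ _ _ m_gt0 n_gt0 s_gt0 u1.
set lhs := prob P _; set bad := prob P _ => split_le.
apply: (@le_trans _ _ lhs); last first.
  apply: (le_trans split_le); rewrite (_ : 9 / n%:R = n%:R^-1 + 8 / n%:R).
    by rewrite lerD2l.
  by field; rewrite pnatr_eq0 -lt0n.
apply: le_prob.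
- apply: measurable_le_cst.
  have [] // : bounded_mfun (fun w => d%:R * dotv u (X w) ^+ 2).
  by apply: bounded_mfunM; [exact: bounded_mfun_cst|exact: bounded_dotvX].
- exact: measurable_norm_lt.
move=> w /= small.
rewrite -(ltr_pXn2r (n := 2)) ?nnegrE ?divr_ge0 ?mulr_ge0 ?ler0n ?(ltW s_gt0) //.
rewrite real_normK ?num_real // expr_div_n s2.
rewrite -(ltr_pM2l d0); apply: (le_lt_trans small).
(* Since $m\le n$ this is at least $1/(8n^4)$; the 9 in the statement makes the comparison
   strict. *)
have -> : d%:R * ((2 * d%:R)^-1 / (2 * (m%:R * n%:R)) ^+ 2) =
    (8 * m%:R ^+ 2 * n%:R ^+ 2)^-1 :> R.
  by field; rewrite !pnatr_eq0 -!lt0n d_gt0 m_gt0 n_gt0.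
rewrite ltf_pV2 ?posrE ?mulr_gt0 ?exprn_gt0 //.
apply: (@le_lt_trans _ _ (8 * n%:R ^+ 4)).
  rewrite -mulrA ler_pM2l // -[4%N]/(2 + 2)%N exprD ler_pM2r ?exprn_gt0 //.
  by rewrite ler_pXn2r ?nnegrE ?ler0n // ler_nat.
by rewrite ltr_pM2r ?exprn_gt0 // ltr_nat.
Qed.

(** The lower tail costs $9/n$ by [small_ball], the upper one $1/n$ by Markov, as $d\langle
    u,X\rangle^2$ has mean 1. *)
Lemma dotv_concentration n u : (0 < n)%N -> dotv u u = 1 ->
  1 - 10 / n%:R <= prob P [set w |
    (9 * n%:R ^+ 4)^-1 <= d%:R * dotv u (X w) ^+ 2 <= n%:R].
Proof.
move=> n_gt0 u1; set c := (9 * _)^-1.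
have n0 : 0 < n%:R :> R by rewrite ltr0n.
pose f w := d%:R * dotv u (X w) ^+ 2.
have bf : bounded_mfun f.
  by apply: bounded_mfunM; [exact: bounded_mfun_cst|exact: bounded_dotvX].
have [mf _] := bf.
pose low := [set w | f w <= c]; pose high := [set w | n%:R <= f w].
set good := [set w | _].
have mlow : measurable low by exact: measurable_le_cst.
have mhigh : measurable high by exact: measurable_cst_le.
have mgood : measurable good.
  rewrite (_ : good = [set w | c <= f w] `&` [set w | f w <= n%:R]).
    by apply: measurableI; [exact: measurable_cst_le|exact: measurable_le_cst].
  by apply/seteqP; split=> w /= => [/andP[]|[? ?]] //; apply/andP.
have p_low : prob P low <= 9 / n%:R by exact: small_ball.
have p_high : prob P high <= 1 / n%:R.
  apply: (le_trans (markov_bound P f _ bf _ n0)) => [w|].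
    by rewrite mulr_ge0 ?sqr_ge0.
  rewrite meanZ ?mean_sqr_dotv // divff // pnatr_eq0 -lt0n //.
have : 1 <= prob P good + (prob P low + prob P high).
  rewrite -!mean_indic // -!meanD;
    try by do ?apply: bounded_mfunD; exact: bounded_mfun_indic.
  rewrite -[leLHS](mean_cst P); apply: le_mean; first exact: bounded_mfun_cst.
    by do ?apply: bounded_mfunD; exact: bounded_mfun_indic.
  move=> w; rewrite !indicE.
  have [|] := boolP (w \in good); first by rewrite lerDl addr_ge0 ?ler0n.
  have [|] := boolP (w \in low); first by rewrite add0r lerDl ler0n.
  rewrite !notin_setE /low /good /= => /negP; rewrite -ltNge => lt_c /negP.
  rewrite negb_and -!ltNge ltNge (ltW lt_c) /= => lt_n.
  by rewrite mem_set ?add0r // /high /= ltW.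
have -> : 10 / n%:R = 9 / n%:R + 1 / n%:R :> R.
  by field; rewrite pnatr_eq0 -lt0n.
by move: p_low p_high; lra.
Qed.

End spherical.

(** * Covariance matrices *)

Section covariance_matrices.
Context {R : realType} {disp : measure_display} {W : measurableType disp}.
Variable Q : probability W R.

Lemma fine_covarianceC (X Y : W -> R) :
  fine (covariance Q X Y) = fine (covariance Q Y X).
Proof. by rewrite covarianceC. Qed.

Lemma Lfun2_sum (I : Type) (s : seq I) (F : I -> W -> R) (v : I -> R) :
  (forall i, F i \in Lfun Q 2%:E) ->
  (\sum_(i <- s) (v i \o* F i)) \in Lfun Q 2%:E.
Proof.
have le12 : (1 <= 2%:E :> \bar R)%E by rewrite lee_fin ler1n.
by move=> LF; apply: rpred_sum => i _; rewrite Lfun_scale // ler1n.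
Qed.

Lemma fine_covariance_suml (I : Type) (s : seq I) (F : I -> W -> R) (v : I -> R)
    (Y : W -> R) :
  (forall i, F i \in Lfun Q 2%:E) -> Y \in Lfun Q 2%:E ->
  fine (covariance Q (\sum_(i <- s) (v i \o* F i)) Y) =
  \sum_(i <- s) v i * fine (covariance Q (F i) Y).
Proof.
move=> LF LY; have Qfin : Q setT \is a fin_num := fin_num_measure Q _ measurableT.
have L1 X : X \in Lfun Q 2%:E -> X \in Lfun Q 1 by exact: Lfun_subset12.
have Lv i : (v i \o* F i) \in Lfun Q 2%:E by rewrite Lfun_scale // ler1n.
have cfin X : X \in Lfun Q 2%:E -> covariance Q X Y \is a fin_num.
  by move=> LX; exact: (covariance_fin_num (L1 _ LX) (L1 _ LY) (Lfun2_mul_Lfun1 LX LY)).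
elim: s => [|i s ih].
  by rewrite !big_nil -[0]/(cst 0) covariance_cst_l.
rewrite !big_cons -ih.
rewrite covarianceDl ?Lfun2_sum //.
rewrite fineD ?cfin ?Lfun2_sum //.
rewrite (covarianceZl _ (L1 _ (LF i)) (L1 _ LY) (Lfun2_mul_Lfun1 (LF i) LY)).
by rewrite fineM ?cfin.
Qed.

End covariance_matrices.

(** The quadratic form at [v] is the variance of $\sum_i v_ie_i$. *)
Lemma covariance_matrix_sym_psd (R : realType) d (S : 'M[R]_d) :
  covariance_matrix S -> S^T = S /\ forall v, 0 <= dotv v (S *m v).
Proof.
move=> [disp [W [Q [e [Le ->]]]]]; split.
  by apply/matrixP => i j; rewrite !mxE fine_covarianceC.
move=> v; pose Y : W -> R := \sum_i (v i 0 \o* e i).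
have LY : Y \in Lfun Q 2%:E by exact: Lfun2_sum.
suff -> : dotv v (\matrix_(i, j) fine (covariance Q (e i) (e j)) *m v) =
    fine (variance Q Y) by rewrite fine_ge0 // variance_ge0.
rewrite /variance fine_covariance_suml // dotvE; apply: eq_bigr => i _.
rewrite fine_covarianceC fine_covariance_suml // mxE; congr (_ * _).
by apply: eq_bigr => j _; rewrite mxE mulrC fine_covarianceC.
Qed.

(** * The uniform distribution on the sphere *)

Lemma continuous_dotv (R : realType) d (a : 'cV[R]_d) : continuous (dotv a).
Proof.
rewrite (_ : dotv a = fun x => \sum_i a i 0 * x i 0); last first.
  by apply/funext => x; rewrite dotvE.
elim: (index_enum _) => [|i s ih] x.
  rewrite (_ : (fun x : 'cV[R]_d => _) = cst 0); first exact: cst_continuous.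
  by apply/funext => y; rewrite big_nil.
rewrite (_ : (fun x => _) = (fun x : 'cV[R]_d => a i 0 * x i 0) \+
    (fun x : 'cV[R]_d => \sum_(j <- s) a j 0 * x j 0)).
  apply: continuousD; last exact: ih.
  by apply: continuousM; [exact: cst_continuous|exact: coord_continuous].
by apply/funext => y; rewrite big_cons.
Qed.

Lemma borel_dotv (R : realType) d (a : 'cV[R]_d) (B : set R) :
  measurable B -> borel [set x | B (dotv a x)].
Proof.
move=> mB.
have mf : measurable_fun setT
    (dotv a : g_sigma_algebraType (@open 'cV[R]_d) -> R).
  apply: (measurability (RGenOpens.G (R:=R)) (RGenOpens.measurableE R)).
  move=> _ [_ [x [y ->]] <-]; rewrite setTI; apply: sub_sigma_algebra.
  by apply: open_comp; [move=> ? _; exact: continuous_dotv|exact: itv_open].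
by have := mf measurableT _ mB; rewrite setTI.
Qed.

(** The complement of [D] is null. This transfers events between a random vector and a version
    modified off the sphere. *)
Lemma eq_probability_full (R : realType) (disp : measure_display)
    (T : measurableType disp) (P : probability T R) (D A B : set T) :
  measurable D -> measurable A -> measurable B -> P D = 1%E ->
  A `&` D = B `&` D -> P A = P B.
Proof.
move=> mD mA mB PD AB.
suff PE C : measurable C -> P C = P (C `&` D) by rewrite (PE A) // (PE B) // AB.
have PDC : P (~` D) = 0%E by rewrite probability_setC // PD subee.
move=> mC; have PCD : P (C `\` D) = 0%E.
  apply: (@subset_measure0 _ _ _ P _ (~` D)).
  - exact: measurableD.
  - exact: measurableC.
  - by move=> w [].
  exact: PDC.
transitivity (P (C `\` D) + P (C `&` D))%E; first exact: measureDI.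
by rewrite PCD add0e.
Qed.

Section uniform_on_sphere.
Context {R : realType} {d : nat} {disp : measure_display}.
Context {T : measurableType disp} (P : probability T R) (r : T -> 'cV[R]_d).
Hypotheses (d_gt0 : (0 < d)%N) (hr : uniform_on_sphere P r).

Lemma measurable_dotv_uniform a : measurable_fun setT (fun w => dotv a (r w)).
Proof.
move=> _ B mB; rewrite setTI; have [rv _ _] := hr.
exact: (rv _ (borel_dotv _ _ a _ mB)).
Qed.

Lemma measurable_sqr_uniform : measurable_fun setT (fun w => dotv (r w) (r w)).
Proof.
rewrite (_ : (fun w => _) = fun w => \sum_i dotv (delta_mx i 0) (r w) ^+ 2).
  by apply: measurable_sum => i; apply: measurable_funX; exact: measurable_dotv_uniform.
by apply/funext => w; rewrite dotvE; apply: eq_bigr => i _; rewrite dotv_delta.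
Qed.

Let D := [set w | dotv (r w) (r w) = 1].

Let mD : measurable D.
Proof.
by have := measurable_sqr_uniform measurableT _ (measurable_set1 1); rewrite setTI.
Qed.

Let PD : P D = 1%E.
Proof.
have [_ <- _] := hr; congr (P _).
apply/seteqP; split=> w; rewrite /D /= => h; last by rewrite -enorm_sqr h expr1n.
by rewrite /enorm h sqrtr1.
Qed.

(** Invariance under an orthogonal [H] with $\langle a,Hx\rangle=\langle b,x\rangle$, applied to the
    Borel set of all $x$ with $\langle a,x\rangle\in B$. *)
Lemma dotv_uniform_law a b (B : set R) : dotv a a = dotv b b -> measurable B ->
  P [set w | B (dotv a (r w))] = P [set w | B (dotv b (r w))].
Proof.
move=> ab mB; have [_ _ inv] := hr.
have [H [HH dH]] := orthogonal_dotv _ _ ab.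
rewrite -(inv H [set x | B (dotv a x)] HH (borel_dotv _ _ a _ mB)).
by congr (P _); apply/seteqP; split=> w /=; rewrite dH.
Qed.

(* r corrected on a null set, so that all moments are bounded. *)
Let r1 w := if dotv (r w) (r w) == 1 then r w else delta_mx (Ordinal d_gt0) 0.

Let r1_unit w : dotv (r1 w) (r1 w) = 1.
Proof. by rewrite /r1; case: ifP => [/eqP//|_]; rewrite dotv_delta mxE !eqxx. Qed.

Let r1E w : D w -> r1 w = r w.
Proof. by rewrite /D /r1 /= => ->; rewrite eqxx. Qed.

Let measurable_dotv_r1 a : measurable_fun setT (fun w => dotv a (r1 w)).
Proof.
rewrite (_ : (fun w => _) = fun w => if dotv (r w) (r w) == 1 then dotv a (r w)
    else dotv a (delta_mx (Ordinal d_gt0) 0)); last first.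
  by apply/funext => w; rewrite /r1; case: ifP.
apply: measurable_fun_ifT.
- by apply: measurable_fun_eqr; [exact: measurable_sqr_uniform|exact: measurable_cst].
- exact: measurable_dotv_uniform.
- exact: measurable_cst.
Qed.

Let P_r1 a (B : set R) : measurable B ->
  P [set w | B (dotv a (r1 w))] = P [set w | B (dotv a (r w))].
Proof.
move=> mB; apply: (@eq_probability_full _ _ _ P D) => //.
- by rewrite -[X in measurable X]setTI; exact: measurable_dotv_r1.
- by rewrite -[X in measurable X]setTI; exact: measurable_dotv_uniform.
by apply/seteqP; split=> w /= [? Dw]; split=> //; move: (r1E w Dw) => E; congruence.
Qed.

(** Concentration is known for [r1], as the event [G]. On [D], where [r1] equals [r], [G] is
    contained in [A], so [A] and its union with [G] are equally probable. *)
Lemma uniform_concentration n u (A : set T) : (0 < n)%N -> dotv u u = 1 ->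
  measurable A ->
  (forall w, dotv (r w) (r w) = 1 ->
     (9 * n%:R ^+ 4)^-1 <= d%:R * dotv u (r w) ^+ 2 <= n%:R -> A w) ->
  ((1 - 10 / n%:R)%:E <= P A)%E.
Proof.
move=> n_gt0 u1 mA sub.
have law a b : dotv a a = dotv b b -> forall B : set R, measurable B ->
    P [set w | B (dotv a (r1 w))] = P [set w | B (dotv b (r1 w))].
  by move=> ab B mB; rewrite !P_r1 //; exact: dotv_uniform_law.
have := dotv_concentration P d r1 d_gt0 measurable_dotv_r1 r1_unit law n u n_gt0 u1.
set G := [set w | _] => le_G.
have mf : measurable_fun setT (fun w => d%:R * dotv u (r1 w) ^+ 2).
  apply: measurable_funM; first exact: measurable_cst.
  by apply: measurable_funX; exact: measurable_dotv_r1.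
have mG : measurable G.
  rewrite (_ : G = [set w | (9 * n%:R ^+ 4)^-1 <= d%:R * dotv u (r1 w) ^+ 2] `&`
      [set w | d%:R * dotv u (r1 w) ^+ 2 <= n%:R]).
    by apply: measurableI; [exact: measurable_cst_le|exact: measurable_le_cst].
  by apply/seteqP; split=> w /= => [/andP[]|[? ?]] //; apply/andP.
have PG : ((1 - 10 / n%:R)%:E <= P G)%E by rewrite (probE P _ mG) lee_fin.
have mAG : measurable (A `|` G) by exact: measurableU.
rewrite (@eq_probability_full _ _ _ P D A (A `|` G)) //.
  by apply: (le_trans PG); apply: le_measure; rewrite ?inE.
apply/seteqP; split=> w /= [wA Dw]; split=> //; first by left.
by case: wA => //; rewrite /G /= r1E //; exact: sub.
Qed.

End uniform_on_sphere.

(** * The efficiency as a scalar product, and the uniform bounds *)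

(** $A^{-1}SA^{-1}$ is the identity, so $\tau^2=\|x\|^2$; this norm is kept because the uniform
    vector has norm 1 only almost surely. *)
Lemma efficiency_sqr (R : realType) d (S A : 'M[R]_d) (Delta x : 'cV[R]_d) :
  A^T = A -> A *m A = S -> A \in unitmx ->
  efficiency S Delta (invmx A *m x) ^+ 2 =
  dotv (invmx A *m Delta) x ^+ 2 / dotv x x.
Proof.
move=> AT AA Au; have BT : (invmx A)^T = invmx A by rewrite trmx_inv AT.
rewrite /efficiency /tau expr_div_n real_normK ?num_real //.
rewrite dotv_mulmxl BT; congr (_ / _).
  by rewrite dotv_mulmxl BT.
by rewrite -AA !mulmxA mulVmx // mul1mx mulmxV // mul1mx sqr_sqrtr // dotv_ge0.
Qed.

(** Denominators are cleared where [g] is positive; where [g] vanishes the quotient is 0 by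
    convention, and $c>0$ excludes it. *)
Lemma measurable_ratio_between (R : realType) (disp : measure_display)
    (T : measurableType disp) (f g : T -> R) (c C : R) :
  measurable_fun setT f -> measurable_fun setT g -> (forall w, 0 <= g w) ->
  0 < c -> measurable [set w | c <= f w / g w <= C].
Proof.
move=> mf mg g0 c0.
rewrite (_ : [set w | _] = ~` [set w | g w <= 0] `&`
   ([set w | 0 <= f w - c * g w] `&` [set w | 0 <= C * g w - f w])).
  apply: measurableI.
    by apply: measurableC; exact: measurable_le_cst.
  by apply: measurableI; apply: measurable_cst_le; apply: measurable_funB => //;
     apply: measurable_funM => //; exact: measurable_cst.
apply/seteqP; split=> w /=; have := g0 w; rewrite le_eqVlt.
  move=> /predU1P[<-|gw]; first by rewrite invr0 mulr0 leNgt c0.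
  rewrite ler_pdivlMr // ler_pdivrMr // => /andP[? ?].
  by rewrite !subr_ge0; split=> //; apply/negP; rewrite -ltNge.
move=> /predU1P[<-|gw]; first by rewrite lexx => -[].
by rewrite ler_pdivlMr // ler_pdivrMr // !subr_ge0 => -[_ [-> ->]].
Qed.

Theorem theorem2p7 (R : realType)
    (Sigma : forall d : nat, 'M[R]_d) (Delta : forall d : nat, 'cV[R]_d)
    (disp : nat -> measure_display) (T : forall d : nat, measurableType (disp d))
    (P : forall d : nat, probability (T d) R)
    (r : forall d : nat, T d -> 'cV[R]_d)
    (hSigma : forall d : nat, (0 < d)%N ->
       covariance_matrix (Sigma d) /\ Sigma d \in unitmx)
    (hDelta : forall d : nat, (0 < d)%N -> enorm (Delta d) != 0)
    (hr : forall d : nat, (0 < d)%N -> uniform_on_sphere (P d) (r d)) :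
  forall eps : R, 0 < eps ->
  exists c C : R, 0 < c /\ 0 < C /\
    forall d : nat, (0 < d)%N ->
      ((1 - eps)%:E <=
        P d [set w | (c <= efficiency (Sigma d) (Delta d)
                             (inv_sqrtmx (Sigma d) *m r d w)%R ^+ 2
                           * (d%:R / enorm (inv_sqrtmx (Sigma d) *m Delta d) ^+ 2)
                        <= C)%R])%E.
Proof.
(* An integer above $10/\epsilon$, so that the exceptional probability $10/n$ is at most
   $\epsilon$. *)
move=> eps eps_gt0; pose n := (Num.truncn (10 / eps)).+1.
have n0 : 0 < n%:R :> R by rewrite ltr0n.
have n_eps : 10 / n%:R <= eps.
  by rewrite ler_pdivrMr // mulrC -ler_pdivrMr // ltW // truncnS_gt.
exists (9 * n%:R ^+ 4)^-1, n%:R; split.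
  by rewrite invr_gt0 mulr_gt0 // exprn_gt0.
split=> // d d_gt0.
have [covS Su] := hSigma d d_gt0.
have [S_sym S_psd] := covariance_matrix_sym_psd _ _ _ covS.
have [[A_sym _] AA] := sqrtmxP _ _ _ S_sym S_psd Su.
have Au : sqrtmx (Sigma d) \in unitmx.
  by move: Su; rewrite -{1}AA unitmx_mul => /andP[].
have Delta0 : Delta d != 0.
  apply: contra_neq (hDelta d d_gt0) => ->.
  by apply/eqP; rewrite -sqrf_eq0 enorm_sqr dotv_eq0.
set v := inv_sqrtmx (Sigma d) *m Delta d.
have v0 : v != 0.
  apply: contra_neq Delta0 => v0.
  by rewrite -[Delta d](mulKVmx Au) -/(inv_sqrtmx _) -/v v0 mulmx0.
have q0 : 0 < enorm v.
  by rewrite sqrtr_gt0 lt_def dotv_eq0 v0 dotv_ge0.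
(* The unit vector is $\Sigma^{-1/2}\Delta$ divided by its norm, which absorbs the normalising
   factor of the efficiency. *)
have effE w : efficiency (Sigma d) (Delta d) (inv_sqrtmx (Sigma d) *m r d w) ^+ 2 *
    (d%:R / enorm v ^+ 2) =
    d%:R * dotv ((enorm v)^-1 *: v) (r d w) ^+ 2 / dotv (r d w) (r d w).
  rewrite (efficiency_sqr _ _ _ _ _ _ A_sym AA Au) -/(inv_sqrtmx _) -/v dotvZl.
  by rewrite exprMn exprVn; ring.
apply: le_trans (_ : ((1 - 10 / n%:R)%:E <= _)%E).
  by rewrite lee_fin lerB.
apply: (@uniform_concentration _ _ _ _ _ _ d_gt0 (hr d d_gt0) n
  ((enorm v)^-1 *: v)) => //.
- by rewrite dotvZl dotvZr -enorm_sqr; field; rewrite gt_eqF.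
- under eq_set do rewrite effE.
  apply: measurable_ratio_between.
  + apply: measurable_funM; first exact: measurable_cst.
    apply: measurable_funX; exact: measurable_dotv_uniform (hr d d_gt0) _.
  + exact: measurable_sqr_uniform (hr d d_gt0).
  + by move=> w; exact: dotv_ge0.
  + by rewrite invr_gt0 mulr_gt0 // exprn_gt0.
by move=> w rw /=; rewrite effE rw divr1.
Qed.
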